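(* Let $n\ge 1$ and $N=2^n$. For every permutation $\pi=[\pi^0\;\pi^1\;\dots\;\pi^{n-1}]$ of $\{0,1,\dots,n-1\}$ (a permuted factor graph for length-$N$ polar codes), the shuffling matrix $\mathbf{V}_\pi$, i.e. the $N\times N$ permutation matrix satisfying $\mathbf{B}_\pi^{\mathsf T}\cdot\mathbf{V}_\pi=\mathbf{B}^{\mathsf T}$, can be written as a finite product (repetitions allowed, the empty product being the identity $\mathbf{I}_N$) of matrices each of which belongs to the fixed set of $n-1$ sub-shuffling matrices $\{\mathbf{V}_{i-1,i} : 1\le i\le n-1\}$.
   Context: All indices start at $0$. For a length-$N$ vector $\bm{b}$, $\bm{b}_x^y$ denotes the sub-vector $[b_x\;b_{x+1}\;\dots\;b_y]$. For $0\le i\le n-1$, $\bm{b}_i$ is the length-$N$ binary column vector consisting of $2^{n-i-1}$ consecutive copies of the pattern ($2^i$ zeros followed by $2^i$ ones); equivalently, its $r$-th entry ($0\le r<N$) is the coefficient of $2^i$ in the binary expansion of $r$. $\mathbf{B}=[\bm{b}_{n-1}\;\bm{b}_{n-2}\;\dots\;\bm{b}_1\;\bm{b}_0]$ is an $N\times n$ binary matrix, and for a permutation $\pi$ of $\{0,\dots,n-1\}$, $\mathbf{B}_\pi=[\bm{b}_{\pi^{n-1}}\;\bm{b}_{\pi^{n-2}}\;\dots\;\bm{b}_{\pi^1}\;\bm{b}_{\pi^0}]$. A permutation matrix $\mathbf{V}_\pi$ with $\mathbf{B}_\pi^{\mathsf T}\mathbf{V}_\pi=\mathbf{B}^{\mathsf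 T}$ exists and is unique, since the rows of $\mathbf{B}_\pi$ and of $\mathbf{B}$ each list all binary strings of length $n$ exactly once. For $1\le i\le n-1$, the sub-shuffling matrix $\mathbf{V}_{i-1,i}$ is the $N\times N$ permutation matrix acting on length-$N$ row vectors as follows: it divides $\bm{b}^{\mathsf T}$ into $2^{n-i-1}$ consecutive groups of length $2^{i+1}$, divides each group into $4$ consecutive blocks of length $2^{i-1}$, and swaps the second and third blocks in every group. That is, for the first group, $$\bm{b}^{\mathsf T}\cdot\mathbf{V}_{i-1,i}=[\,\bm{b}_{0}^{2^{i-1}-1}\;\;\bm{b}_{2^{i}}^{2^{i}+2^{i-1}-1}\;\;\bm{b}_{2^{i-1}}^{2^{i}-1}\;\;\bm{b}_{2^{i}+2^{i-1}}^{2^{i+1}-1}\;\dots\,],$$ and likewise for each of the following groups. *)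

(* Defs.v *)
From HB Require Import structures.
From mathcomp Require Import all_boot all_order all_algebra all_fingroup.
From mathcomp Require Import zify.

Set Implicit Arguments.
Unset Strict Implicit.
Unset Printing Implicit Defensive.

Import GRing.Theory.
Local Open Scope ring_scope.

(* The coefficient ring R is arbitrary (nonzero): all matrices involved have  *)
(* entries 0 and 1, so the binary case is R = 'F_2, while R may also be the   *)
(* ring in which the vectors to be shuffled have their entries.               *)

Definition bit_col (R : nzRingType) (n i : nat) : 'cV[R]_(2 ^ n) :=
  \col_(r < 2 ^ n)
    nth 0 (flatten (nseq (2 ^ (n - i - 1)) (nseq (2 ^ i) 0 ++ nseq (2 ^ i) 1))) r.

(* rev_ord j has value n - 1 - j: the columns are listed in decreasing order. *)
Definition bit_mx (R : nzRingType) (n : nat) : 'M[R]_(2 ^ n, n) :=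
  \matrix_(r < 2 ^ n, j < n) bit_col R n (rev_ord j) r 0.

Definition perm_bit_mx (R : nzRingType) (n : nat) (pi : 'S_n) :
    'M[R]_(2 ^ n, n) :=
  \matrix_(r < 2 ^ n, j < n) bit_col R n (pi (rev_ord j)) r 0.

Definition is_shuffling_mx (R : nzRingType) (n : nat) (pi : 'S_n)
    (V : 'M[R]_(2 ^ n)) : Prop :=
  is_perm_mx V /\ (perm_bit_mx R pi)^T *m V = (bit_mx R n)^T.

(* A position c is split into its group (of length 2 ^ i.+1), its block inside*)
(* the group (of length 2 ^ i.-1) and its offset inside the block; blocks 1   *)
(* and 2 are exchanged. Meaningful for 0 < i only.                            *)
Definition swap_blocks (i c : nat) : nat :=
  (c %/ 2 ^ i.+1 * 2 ^ i.+1
   + nth 0 [:: 0; 2; 1; 3] (c %% 2 ^ i.+1 %/ 2 ^ i.-1) * 2 ^ i.-1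
   + c %% 2 ^ i.-1)%N.

(* V_(i-1,i): by sub_shuffling_mxE, right multiplication by this matrix puts  *)
(* the entry of index swap_blocks i c at position c.                          *)
Definition sub_shuffling_mx (R : nzRingType) (n i : nat) : 'M[R]_(2 ^ n) :=
  \matrix_(r < 2 ^ n, c < 2 ^ n) (r == swap_blocks i c :> nat)%:R.

Lemma nth_flatten_nseq (T : Type) (x0 : T) k (p : seq T) r :
  (r < k * size p)%N ->
  nth x0 (flatten (nseq k p)) r = nth x0 p (r %% size p).
Proof.
elim: k r => [|k IHk] r; first by rewrite mul0n.
rewrite mulSn /= nth_cat => Hr; case: ltnP => Hp; first by rewrite modn_small.
rewrite IHk; last by rewrite ltn_subLR.
by rewrite -[in RHS](subnK Hp) modnDr.
Qed.

Lemma bit_colE (R : nzRingType) n i (r : 'I_(2 ^ n)) : (i < n)%N ->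
  bit_col R n i r 0 = (odd (r %/ 2 ^ i))%:R.
Proof.
move=> lt_in; rewrite mxE nth_flatten_nseq; last first.
  rewrite size_cat !size_nseq addnn -mul2n -expnS -expnD.
  by rewrite (_ : n - i - 1 + i.+1 = n)%N ?ltn_ord //; lia.
rewrite size_cat !size_nseq addnn -mul2n nth_cat !nth_nseq size_nseq.
have p_gt0 : (0 < 2 ^ i)%N by rewrite expn_gt0.
have -> : odd (r %/ 2 ^ i) = ~~ (r %% (2 * 2 ^ i) < 2 ^ i)%N.
  have := divn_eq r (2 * 2 ^ i); set q := (r %/ _)%N; set m := (r %% _)%N.
  move=> ->; have : (m < 2 * 2 ^ i)%N by rewrite ltn_mod muln_gt0.
  rewrite mulnA divnMDl // oddD oddM andbF /=.
  case: (ltnP m (2 ^ i)) => Hm Hm2; first by rewrite divn_small.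
  rewrite (_ : m = (1 * 2 ^ i + (m - 2 ^ i))%N); last by lia.
  by rewrite divnMDl // divn_small //; lia.
have : (r %% (2 * 2 ^ i) < 2 * 2 ^ i)%N by rewrite ltn_mod muln_gt0.
move: (r %% _)%N => m; case: (ltnP m (2 ^ i)) => Hm Hm2 //=.
by rewrite ifT //; lia.
Qed.

Lemma bits_inj n r r' : (r < 2 ^ n)%N -> (r' < 2 ^ n)%N ->
  (forall i, (i < n)%N -> odd (r %/ 2 ^ i) = odd (r' %/ 2 ^ i)) -> r = r'.
Proof.
elim: n r r' => [|n IHn] r r'; first by case: r r' => [|r] [|r'].
rewrite expnS => Hr Hr' Hb.
have H0 := Hb 0%N isT; rewrite expn0 !divn1 in H0.
suff : (r %/ 2 = r' %/ 2)%N by lia.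
apply: IHn; try lia.
by move=> i Hi; rewrite -!divnMA -!expnS Hb.
Qed.

Definition bits n (pi : 'S_n) (r : 'I_(2 ^ n)) : {ffun 'I_n -> bool} :=
  [ffun j => odd (r %/ 2 ^ pi j)].

Lemma bits_ffun_inj n (pi : 'S_n) : injective (bits pi).
Proof.
move=> r r' /ffunP eq_rr'; apply: val_inj; 
apply: (bits_inj (ltn_ord r) (ltn_ord r')) => i lt_in.
have := eq_rr' (pi^-1%g (Ordinal lt_in)).
by rewrite !ffunE permKV.
Qed.

Lemma shuffling_perm_mxP (R : nzRingType) n (pi : 'S_n) (s : 'S_(2 ^ n)) :
  (perm_bit_mx R pi)^T *m perm_mx s = (bit_mx R n)^T
  <-> forall c, bits pi (s^-1%g c) = bits 1%g c.
Proof.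
have E j c : ((perm_bit_mx R pi)^T *m perm_mx s) j c
             = (bits pi (s^-1%g c) (rev_ord j))%:R.
  rewrite mxE (bigD1 (s^-1%g c)) //= big1 ?addr0 => [|r ne_r].
    by rewrite !mxE permKV eqxx mulr1 ffunE -bit_colE ?mxE.
  rewrite !mxE (_ : s r == c = false) ?mulr0 //.
  by apply: contraNF ne_r => /eqP <-; rewrite permK.
have E' j c : (bit_mx R n)^T j c = (bits 1%g c (rev_ord j))%:R.
  by rewrite !mxE ffunE perm1 -bit_colE ?mxE.
split=> [/matrixP eqV c|eqb]; last first.
  by apply/matrixP => j c; rewrite E E' eqb.
apply/ffunP => j; have := eqV (rev_ord j) c; rewrite E E' rev_ordK.
by case: (bits pi _ j); case: (bits 1 _ j) => //= /eqP;
   rewrite ?(eq_sym 0) oner_eq0.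
Qed.

Lemma shuffling_mx_unique (R : nzRingType) n (pi : 'S_n) :
  exists! V : 'M[R]_(2 ^ n), is_shuffling_mx pi V.
Proof.
have bij_b : bijective (bits pi).
  by apply: inj_card_bij (@bits_ffun_inj n pi) _;
     rewrite card_ffun card_bool !card_ord.
have [g bK gK] := bij_b.
have inj_t : injective (g \o bits 1%g).
  exact: inj_comp (can_inj gK) (@bits_ffun_inj n 1%g).
exists (perm_mx (perm inj_t)^-1%g); split.
  split; first exact: perm_mx_is_perm.
  by apply/shuffling_perm_mxP => c; rewrite invgK permE /= gK.
move=> _ [/is_perm_mxP[s ->] /shuffling_perm_mxP eq_s]; congr perm_mx.
rewrite -[s]invgK; congr (_^-1)%g; apply/permP => c.
by rewrite permE /= -eq_s bK.
Qed.

Lemma swap_blocksE i g k t : (0 < i)%N -> (k < 4)%N -> (t < 2 ^ i.-1)%N ->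
  swap_blocks i (g * 2 ^ i.+1 + k * 2 ^ i.-1 + t)
  = (g * 2 ^ i.+1 + nth 0 [:: 0; 2; 1; 3] k * 2 ^ i.-1 + t)%N.
Proof.
case: i => // i _ /= lt_k lt_t; rewrite /swap_blocks /=.
have E : (2 ^ i.+2 = 4 * 2 ^ i)%N by rewrite !expnS mulnA.
have p_gt0 : (0 < 2 ^ i)%N by rewrite expn_gt0.
rewrite E; set w := (2 ^ i)%N in lt_t p_gt0 *.
have lt_kt : (k * w + t < 4 * w)%N by nia.
rewrite -[(g * (4 * w) + k * w + t)%N]addnA.
have -> : ((g * (4 * w) + (k * w + t)) %% w = t)%N.
  by rewrite mulnA addnA -mulnDl modnMDl modn_small.
rewrite divnMDl ?muln_gt0 //.
rewrite modnMDl (modn_small lt_kt) (divn_small lt_kt) addn0.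
by rewrite divnMDl // (divn_small lt_t) addn0.
Qed.

Lemma swap_blocks_split i c : (0 < i)%N ->
  exists g k t, [/\ (k < 4)%N, (t < 2 ^ i.-1)%N &
                    c = (g * 2 ^ i.+1 + k * 2 ^ i.-1 + t)%N].
Proof.
case: i => // i _ /=.
have E : (2 ^ i.+2 = 4 * 2 ^ i)%N by rewrite !expnS mulnA.
have p_gt0 : (0 < 2 ^ i)%N by rewrite expn_gt0.
exists (c %/ 2 ^ i %/ 4)%N, (c %/ 2 ^ i %% 4)%N, (c %% 2 ^ i)%N.
split; rewrite ?ltn_mod //.
by rewrite E mulnA -mulnDl -divn_eq -divn_eq.
Qed.

Lemma swap_blocksK i : (0 < i)%N -> involutive (swap_blocks i).
Proof.
move=> i_gt0 c; have [g [k [t [lt_k lt_t ->]]]] := swap_blocks_split c i_gt0.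
by rewrite !swap_blocksE //; case: k lt_k => [|[|[|[]]]].
Qed.

Lemma swap_blocks_lt n i c :
  (0 < i < n)%N -> (c < 2 ^ n)%N -> (swap_blocks i c < 2 ^ n)%N.
Proof.
case/andP=> i_gt0 lt_in; have [g [k [t [lt_k lt_t ->]]]] := swap_blocks_split c i_gt0.
rewrite swap_blocksE // -(subnK lt_in) expnD => Hc.
have lt_g : (g < 2 ^ (n - i.+1))%N.
  by rewrite -(ltn_pmul2r (expn_gt0 2 i.+1)); apply: leq_ltn_trans Hc; lia.
have E : (2 ^ i.+1 = 4 * 2 ^ i.-1)%N.
  by case: i i_gt0 {lt_in lt_t Hc lt_g} => // i _; rewrite !expnS mulnA.
have : (nth 0 [:: 0; 2; 1; 3] k < 4)%N by case: k lt_k {Hc} => [|[|[|[]]]].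
move: (nth _ _ _) => k' lt_k'.
apply: (@leq_trans (g.+1 * 2 ^ i.+1)); last by rewrite leq_mul2r lt_g orbT.
rewrite E; nia.
Qed.

Lemma sub_shuffling_mxE (R : nzRingType) n i (Hi : (0 < i < n)%N)
    (x : 'rV[R]_(2 ^ n)) (c : 'I_(2 ^ n)) :
  (x *m sub_shuffling_mx R n i) 0 c
  = x 0 (Ordinal (swap_blocks_lt Hi (ltn_ord c))).
Proof.
rewrite mxE (bigD1 (Ordinal (swap_blocks_lt Hi (ltn_ord c)))) //= big1.
  by rewrite !mxE eqxx mulr1 addr0.
by move=> r /negPf; rewrite -val_eqE /= !mxE => ->; rewrite mulr0.
Qed.

Lemma sub_shuffling_is_perm_mx (R : nzRingType) n i :
  (0 < i < n)%N -> is_perm_mx (sub_shuffling_mx R n i).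
Proof.
move=> Hi; pose f (c : 'I_(2 ^ n)) := Ordinal (swap_blocks_lt Hi (ltn_ord c)).
have /andP[i_gt0 _] := Hi.
have fK : involutive f by move=> c; apply: val_inj; rewrite /= swap_blocksK.
apply/is_perm_mxP; exists (perm (inv_inj fK)); apply/matrixP => r c.
rewrite !mxE permE; congr (_ %:R); congr (nat_of_bool _).
by rewrite -val_eqE /= (can2_eq (swap_blocksK i_gt0) (swap_blocksK i_gt0)).
Qed.

(* Main.v *)
(* V_(i-1,i) exchanges the bits i-1 and i of every position, so right          *)
(* multiplication by it turns the transpose of B_pi into that of B_(pi * t),   *)
(* where t is the adjacent transposition (i-1 i). Adjacent transpositions      *)
(* generate the symmetric group: a factorization of pi^-1 gives a product of   *)
(* sub-shuffling matrices which turns B_pi^T into B^T, and V_pi is the only    *)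
(* permutation matrix that does so.                                            *)
Require Import Defs.
From mathcomp Require Import all_boot all_order all_algebra all_fingroup.
From mathcomp Require Import zify.

Import GRing.Theory.
Local Open Scope ring_scope.

(** Swapping the two middle blocks of a group exchanges two neighbouring binary digits of a position
    ([odd_swap_blocks]), so a sub-shuffling matrix acts on [B_pi^T] by composing [pi] with an
    adjacent transposition. As these generate the symmetric group ([gen_adj_tperm]), a word for
    [pi^-1] spells a product that is a shuffling matrix for [pi], and such a matrix is unique. *)

Definition adj_tperm {m : nat} (i : 'I_m) : 'S_m.+1 :=
  tperm (widen_ord (leqnSn m) i) (lift ord0 i).

(** The transpositions (0 j) generate, and (0 j+1) is the conjugate of (j j+1) by (0 j). *)
Lemma gen_adj_tperm m : <<[set adj_tperm i | i : 'I_m]>>%g = [set: 'S_m.+1].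
Proof.
set A := [set _ | i : _]; apply/eqP.
rewrite eqEsubset subsetT /= -(gen_tperm (ord0 : 'I_m.+1)) gen_subG.
apply/subsetP => _ /imsetP[[j lt_j] _ ->].
elim: j lt_j => [|j IHj] lt_j.
  by rewrite (_ : Ordinal lt_j = ord0) ?tperm1 ?group1 //; apply: val_inj.
have lt_j' : (j < m.+1)%N := ltnW lt_j.
pose i : 'I_m := Ordinal (lt_j : (j < m)%N).
have Ei : widen_ord (leqnSn m) i = Ordinal lt_j' by apply: val_inj.
have Ei' : lift ord0 i = Ordinal lt_j by apply: val_inj.
have Ai : tperm (Ordinal lt_j') (Ordinal lt_j) \in <<A>>%g.
  by rewrite -Ei -Ei' mem_gen //; apply: imset_f.
have ne_jSj : Ordinal lt_j' != Ordinal lt_j by rewrite -val_eqE /= ltn_eqF.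
rewrite -(tpermJ_tperm ne_jSj (isT : ord0 != Ordinal lt_j)).
by rewrite groupJ // tpermC IHj.
Qed.

(** The block number [k] consists of the digits i and i+1 of [c]; exchanging blocks 1 = 01 and 2 =
    10 exchanges these digits. *)
Lemma odd_swap_blocks {m} (i : 'I_m) (j : 'I_m.+1) c :
  odd (swap_blocks i.+1 c %/ 2 ^ j) = odd (c %/ 2 ^ adj_tperm i j).
Proof.
have [g [k [t [lt_k lt_t ->]]]] := swap_blocks_split c (ltn0Sn i).
rewrite swap_blocksE //=; rewrite /= in lt_t.
have p_gt0 e : (0 < 2 ^ e)%N by rewrite expn_gt0.
have E2 : (2 ^ i.+2 = 4 * 2 ^ i)%N by rewrite !expnS mulnA.
have lo k' : ((g * 2 ^ i.+2 + k' * 2 ^ i + t) %/ 2 ^ i = g * 4 + k')%N.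
  by rewrite E2 mulnA -mulnDl divnMDl // divn_small // addn0.
have hi k' : ((g * 2 ^ i.+2 + k' * 2 ^ i + t) %/ 2 ^ i.+1 = g * 2 + k' %/ 2)%N.
  by rewrite (expnSr 2 i) divnMA lo (_ : 4 = 2 * 2)%N // mulnA divnMDl.
rewrite /adj_tperm; case: tpermP => [->|->|ne_i ne_Si] /=.
- by rewrite lo hi !oddD !oddM !andbF; case: k lt_k => [|[|[|[]]]].
- by rewrite /bump /= lo hi !oddD !oddM !andbF; case: k lt_k => [|[|[|[]]]].
have {}ne_i : (j : nat) <> i by move=> eq_ji; apply: ne_i; apply: val_inj.
have {}ne_Si : (j : nat) <> i.+1 by move=> eq_ji; apply: ne_Si; apply: val_inj.
case: (ltnP j i) => [lt_ji|le_ij].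
  (* Digits below i come from the offset [t] alone. *)
  have low k' : odd ((g * 2 ^ i.+2 + k' * 2 ^ i + t) %/ 2 ^ j)
                = odd (t %/ 2 ^ j).
    rewrite E2 mulnA -mulnDl -(subnK lt_ji) addnS -addSn expnD mulnA.
    by rewrite divnMDl // oddD oddM oddX andbF.
  by rewrite !low.
(* Digits above i+1 come from the group number [g] alone. *)
have high k' : (k' < 4)%N ->
    ((g * 2 ^ i.+2 + k' * 2 ^ i + t) %/ 2 ^ j = g %/ 2 ^ (j - i.+2))%N.
  move=> lt_k'; have -> : (2 ^ j = 2 ^ i.+2 * 2 ^ (j - i.+2))%N.
    by rewrite -expnD subnKC //; lia.
  rewrite divnMA -addnA divnMDl // (divn_small (d := 2 ^ i.+2)%N) ?addn0 //.
  by rewrite E2; nia.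
by rewrite !high //; case: k lt_k => [|[|[|[]]]].
Qed.

Lemma perm_bit_mxE (R : nzRingType) {n} (pi : 'S_n) (r : 'I_(2 ^ n)) j :
  perm_bit_mx R pi r j = (odd (r %/ 2 ^ pi (rev_ord j)))%:R.
Proof. by rewrite -bit_colE // !mxE. Qed.

Lemma perm_bit_mxM_sub_shuffling (R : nzRingType) {m} (pi : 'S_m.+1) (i : 'I_m) :
  (perm_bit_mx R pi)^T *m sub_shuffling_mx R m.+1 i.+1
  = (perm_bit_mx R (pi * adj_tperm i)%g)^T.
Proof.
have Hi : (0 < i.+1 < m.+1)%N := ltn_ord i.
apply/matrixP => j c.
rewrite mxE (bigD1 (Ordinal (swap_blocks_lt Hi (ltn_ord c)))) //= big1.
  rewrite [sub_shuffling_mx _ _ _ _ _]mxE eqxx mulr1 addr0.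
  by rewrite 2![trmx _ _ _]mxE !perm_bit_mxE permM /= odd_swap_blocks.
by move=> r /negPf; rewrite -val_eqE /= !mxE => ->; rewrite mulr0.
Qed.

(** [pi] is general because the induction on [l] absorbs each head factor into it. *)
Lemma prod_sub_shuffling_is_shuffling (R : nzRingType) {m} (l : seq 'I_m)
    (pi : 'S_m.+1) :
  (pi * \prod_(i <- l) adj_tperm i)%g = 1%g ->
  is_shuffling_mx pi (\big[mulmx/1%:M]_(i <- l) sub_shuffling_mx R m.+1 i.+1).
Proof.
elim: l pi => [|i l IHl] pi.
  rewrite !big_nil mulg1 => ->; split; first exact: is_perm_mx1.
  by rewrite mulmx1; congr (_^T); apply/matrixP => r j; rewrite !mxE perm1.
rewrite !big_cons mulgA => /IHl[perm_W eqW]; split.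
  by rewrite is_perm_mxMr //; apply: sub_shuffling_is_perm_mx; apply: ltn_ord.
by rewrite mulmxA perm_bit_mxM_sub_shuffling.
Qed.

Theorem theorem1 (R : nzRingType) (n : nat) (n_ge1 : (1 <= n)%N) (pi : 'S_n)
    (V : 'M[R]_(2 ^ n)) (hV : is_shuffling_mx pi V) :
  exists s : seq nat,
    (forall i : nat, i \in s -> (1 <= i <= n - 1)%N) /\
    V = \big[mulmx/1%:M]_(i <- s) sub_shuffling_mx R n i.
Proof.
case: n n_ge1 pi V hV => // m _ pi V hV.
have : pi^-1%g \in <<[set adj_tperm i | i : 'I_m]>>%g.
  by rewrite gen_adj_tperm inE.
(* In a finite group, a word in the generators needs no inverses. *)
case/gen_prodgP => k [c Ac eq_pi].
have /fin_all_exists[f Ef] (i : 'I_k) : exists j, c i = adj_tperm j.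
  by have /imsetP[j _ ->] := Ac i; exists j.
pose l := [seq f i | i <- index_enum 'I_k].
exists [seq (i : 'I_m).+1 | i <- l]; split.
  by move=> _ /mapP[i _ ->]; rewrite subn1 ltn_ord.
have [W [_ W_uniq]] := shuffling_mx_unique R pi.
rewrite big_map -(W_uniq _ hV); apply: W_uniq.
apply: prod_sub_shuffling_is_shuffling.
by rewrite big_map -(eq_bigr _ (fun i _ => Ef i)) -eq_pi mulgV.
Qed.
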